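(* Let $X\in\mathrm{Conf}_n(\mathbb{R}^k)$ be a fixed configuration, and let $\pi,\sigma\in\mathrm{Iso}(\mathbb{R}^k)$ be two isometries. Then $$|\mu(X,\pi)-\mu(X,\sigma)|\leq d_{X,p}(\pi,\sigma).$$
   Context: Fix $n\geq2$ and $p\geq1$. $\mathrm{Conf}_n(\mathbb{R}^k)$ is the set of subsets of $n$ distinct points of $\mathbb{R}^k$; $d$ is the Euclidean distance. The symmetry defect of $X$ with respect to an isometry $\pi$ is $\mu(X,\pi)=\big(\inf_{\gamma\neq\pi|_X}\sum_{x\in X}d(x,\gamma(x))^p\big)^{1/p}$, the infimum being over all bijections $\gamma:X\to\pi(X)$ other than the restriction $\pi|_X$. For isometries $\pi,\sigma$, $d_{X,p}(\pi,\sigma)=\big(\sum_{x\in X}d(\pi(x),\sigma(x))^p\big)^{1/p}$. *)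

(* Defs.v *)
From mathcomp Require Import all_boot all_order all_algebra finmap.
From mathcomp Require Import all_classical all_reals all_analysis.

Set Implicit Arguments.
Unset Strict Implicit.
Unset Printing Implicit Defensive.

Import Order.TTheory GRing.Theory Num.Theory.

Local Open Scope classical_set_scope.
Local Open Scope ring_scope.

(* The norm that MathComp-Analysis puts on ['rV[R]_k] is the sup norm, hence
   this explicit distance. *)
Definition eucl_dist (R : realType) (k : nat) (x y : 'rV[R]_k) : R :=
  Num.sqrt (\sum_(i < k) (x 0 i - y 0 i) ^+ 2).

(* Bijectivity is included so that these are the elements of the group Iso(R^k). *)
Definition is_isometry (R : realType) (k : nat) (f : 'rV[R]_k -> 'rV[R]_k) :
    Prop :=
  bijective f /\ forall x y, eucl_dist (f x) (f y) = eucl_dist x y.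

Definition Conf (R : realType) (n k : nat) : set {fset 'rV[R]_k} :=
  [set X | #|` X|%fset = n].

Arguments Conf R n k _ : clear implicits.

(* For a finite set [X], its elements form the finite type [X] with coercion
   [val] to the ambient space, and [(f @` X)%fset] is the image f(X). *)
Definition restriction (T : choiceType) (f : T -> T) (X : {fset T}) :
    X -> (f @` X)%fset :=
  fun x => [` in_imfset imfset_key f (fsvalP x)]%fset.

Definition other_bijections (T : choiceType) (f : T -> T) (X : {fset T}) :
    set (X -> (f @` X)%fset) :=
  [set g | bijective g /\ g <> @restriction T f X].

Arguments other_bijections {T} f X _.

(* [inf] is only meaningful on a nonempty set bounded below: here the sums are
   nonnegative, and [other_bijections f X] is inhabited as soon as [f] is
   injective and [X] has at least two points. *)
Definition symmetry_defect (R : realType) (k : nat) (p : R)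
    (X : {fset 'rV[R]_k}) (f : 'rV[R]_k -> 'rV[R]_k) : R :=
  (inf [set \sum_(x : X) eucl_dist (val x) (val (g x)) `^ p
       | g in other_bijections f X]) `^ p^-1.

Definition isometry_dist (R : realType) (k : nat) (p : R)
    (X : {fset 'rV[R]_k}) (f g : 'rV[R]_k -> 'rV[R]_k) : R :=
  (\sum_(x : X) eucl_dist (f (val x)) (g (val x)) `^ p) `^ p^-1.

(* Main.v *)
Require Import Defs.
From mathcomp Require Import all_boot all_order all_algebra finmap.
From mathcomp Require Import all_classical all_reals all_analysis.
From mathcomp Require Import perm.
Import Order.TTheory GRing.Theory Num.Theory.
Local Open Scope classical_set_scope.
Local Open Scope ring_scope.

(** The isometry [f] identifies the bijections from X to f(X) with the
    permutations [t] of X, through [f \o t], and the excluded bijection with the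
    identity. Once bijections are named by permutations, the competitors for
    [pi] and for [sigma] are the same objects, so their costs can be compared
    one permutation at a time. If [c f t] is the p-norm of the family
    d(x, f(t x)), the Euclidean triangle inequality through g(t x), followed by
    Minkowski's inequality, gives
      [c f t <= c g t + (sum over x of d(g(t x), f(t x))^p)^(1/p)],
    and the last term is the distance between [f] and [g] on X because [t] only
    permutes its summands ([shuffle_cost_le_add]). The defect is the greatest
    lower bound of the costs of the non-identity permutations
    ([symmetry_defect_le_cost], [le_symmetry_defect]), so the defect of [f]
    exceeds that of [g] by at most the distance between them
    ([symmetry_defect_le_add]); exchanging [f] and [g] bounds the absolute value.

    Minkowski's inequality for finite sums ([ler_lp_normD]) follows from the
    convexity of the power function. Its case p = 2 is also the Euclidean
    triangle inequality ([ler_eucl_distD]). *)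

(** * Minkowski's inequality for finite sums *)

Lemma powRK {R : realType} {p x : R} :
  p != 0 -> 0 <= x -> (x `^ p) `^ p^-1 = x.
Proof. by move=> p0 x0; rewrite -powRrM divff// powRr1. Qed.

(** The absolute value lets the same norm serve for coordinate differences and
    for families of distances. *)
Definition lp_norm {R : realType} {I : finType} (p : R) (a : I -> R) : R :=
  (\sum_i `|a i| `^ p) `^ p^-1.

Lemma lp_norm_ge0 {R : realType} {I : finType} (p : R) (a : I -> R) :
  0 <= lp_norm p a.
Proof. exact: powR_ge0. Qed.

Lemma lp_norm_powR {R : realType} {I : finType} (p : R) (a : I -> R) :
  p != 0 -> lp_norm p a `^ p = \sum_i `|a i| `^ p.
Proof.
move=> p0; rewrite /lp_norm -powRrM mulVf// powRr1//.
by apply: sumr_ge0 => i _; exact: powR_ge0.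
Qed.

Lemma le_lp_norm {R : realType} {I : finType} (p : R) (a b : I -> R) :
  0 <= p -> (forall i, `|a i| <= `|b i|) -> lp_norm p a <= lp_norm p b.
Proof.
move=> p0 ab; apply: ge0_ler_powR; rewrite ?invr_ge0//.
- by rewrite nnegrE; apply: sumr_ge0 => i _; exact: powR_ge0.
- by rewrite nnegrE; apply: sumr_ge0 => i _; exact: powR_ge0.
by apply: ler_sum => i _; apply: ge0_ler_powR; rewrite ?nnegrE.
Qed.

Lemma lp_norm_reindex {R : realType} {I : finType} (p : R) (a : I -> R)
    (t : I -> I) : bijective t -> lp_norm p (a \o t) = lp_norm p a.
Proof.
by move=> tb; rewrite /lp_norm [in RHS](reindex t) //; exact: onW_bij.
Qed.


Lemma sum_powR_div_le1 {R : realType} {I : finType} {p s : R} {a : I -> R} :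
  0 < s -> (forall i, 0 <= a i) -> \sum_i a i `^ p <= s `^ p ->
  \sum_i (a i / s) `^ p <= 1.
Proof.
move=> s0 a0 sa; rewrite -(ler_pM2r (powR_gt0 p s0)) mul1r mulr_suml.
apply: le_trans sa; apply: ler_sum => i _.
by rewrite -powRM ?divr_ge0 ?(ltW s0)// divfK// gt_eqF.
Qed.

(** Minkowski's inequality in the form of upper bounds: (a + b) / (s + t) is the
    convex combination of a / s and b / t with weights s / (s + t) and
    t / (s + t), and each of these two families has p-th powers summing to at
    most one. Taking [s] and [t] to be any positive upper bounds, rather than the
    norms themselves, spares the case where a norm vanishes. *)
Lemma sum_powRD_le {R : realType} {I : finType} {p s t : R} {a b : I -> R} :
  1 <= p -> 0 < s -> 0 < t ->
  (forall i, 0 <= a i) -> (forall i, 0 <= b i) ->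
  \sum_i a i `^ p <= s `^ p -> \sum_i b i `^ p <= t `^ p ->
  \sum_i (a i + b i) `^ p <= (s + t) `^ p.
Proof.
move=> p1 s0 t0 a0 b0 sa tb.
have st0 : 0 < s + t by exact: addr_gt0.
set l := s / (s + t).
have l0 : 0 <= l by rewrite divr_ge0// ltW.
have l1 : l <= 1 by rewrite ler_pdivrMr// mul1r lerDl ltW.
have sl : (s + t) * l = s by rewrite mulrC divfK// gt_eqF.
have tl : (s + t) * (1 - l) = t by rewrite mulrBr mulr1 sl addrC addKr.
clearbody l; have pw i : (a i + b i) `^ p <=
    (s + t) `^ p * (l * (a i / s) `^ p + (1 - l) * (b i / t) `^ p).
  have as0 : 0 <= a i / s by rewrite divr_ge0// ltW.
  have bt0 : 0 <= b i / t by rewrite divr_ge0// ltW.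
  have -> : a i + b i = (s + t) * (l * (a i / s) + (1 - l) * (b i / t)).
    by rewrite mulrDr !mulrA sl tl !(mulrC _ (_^-1)) !mulKf ?gt_eqF.
  rewrite powRM ?(ltW st0)//; last by rewrite addr_ge0// mulr_ge0// subr_ge0.
  rewrite ler_wpM2l ?powR_ge0//.
  by apply: (convex_powR p1 (Itv01 l0 l1)); rewrite inE/= in_itv/= andbT.
apply: (le_trans (ler_sum _ (fun i _ => pw i))).
rewrite -mulr_sumr -[leRHS]mulr1 ler_wpM2l ?powR_ge0//.
rewrite big_split/= -!mulr_sumr -[leRHS](subrKC l).
by rewrite lerD// ler_piMr ?subr_ge0// sum_powR_div_le1.
Qed.

Lemma ler_lp_normD {R : realType} {I : finType} {p : R} (a b : I -> R) :
  1 <= p -> lp_norm p (fun i => a i + b i) <= lp_norm p a + lp_norm p b.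
Proof.
move=> p1; have p0 : 0 < p by exact: lt_le_trans p1.
have e (c : I -> R) d : 0 < d -> \sum_i `|c i| `^ p <= (lp_norm p c + d) `^ p.
  move=> d0; rewrite -lp_norm_powR ?gt_eqF//.
  apply: ge0_ler_powR; rewrite ?nnegrE ?lp_norm_ge0 ?(ltW p0)//.
    by rewrite addr_ge0 ?lp_norm_ge0// ltW.
  by rewrite lerDl ltW.
(* Enlarging both norms by d / 2 makes them positive. *)
apply/ler_addgt0Pl => d d0; have d20 : 0 < d / 2 by rewrite divr_gt0.
have sm (c : I -> R) : 0 < lp_norm p c + d / 2.
  by rewrite ltr_wpDl ?lp_norm_ge0.
have H := sum_powRD_le p1 (sm a) (sm b) (fun i => normr_ge0 (a i))
  (fun i => normr_ge0 (b i)) (e a _ d20) (e b _ d20).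
have -> : d + (lp_norm p a + lp_norm p b) =
    (lp_norm p a + d / 2) + (lp_norm p b + d / 2).
  by rewrite addrACA -splitr addrC.
set r := leRHS; rewrite -/r in H.
have r0 : 0 <= r by rewrite /r addr_ge0 // ltW.
rewrite -[leRHS](@powRK _ p) ?gt_eqF//.
apply: ge0_ler_powR.
- by rewrite invr_ge0 ltW.
- by rewrite nnegrE; apply: sumr_ge0 => i _; exact: powR_ge0.
- by rewrite nnegrE powR_ge0.
apply: le_trans H; apply: ler_sum => i _.
by apply: ge0_ler_powR; rewrite ?nnegrE ?addr_ge0 ?(ltW p0) ?ler_normD.
Qed.

(** * Euclidean distances *)

Lemma eucl_dist_lp_norm {R : realType} {k : nat} (x y : 'rV[R]_k) :
  eucl_dist x y = lp_norm 2 (fun i => x 0 i - y 0 i).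
Proof.
rewrite /eucl_dist /lp_norm -powR12_sqrt; last first.
  by apply: sumr_ge0 => i _; exact: sqr_ge0.
congr (_ `^ _); apply: eq_bigr => i _.
by rewrite powR_mulrn// real_normK ?num_real.
Qed.

Lemma eucl_dist_ge0 {R : realType} {k : nat} (x y : 'rV[R]_k) :
  0 <= eucl_dist x y.
Proof. exact: sqrtr_ge0. Qed.

Lemma eucl_distC {R : realType} {k : nat} (x y : 'rV[R]_k) :
  eucl_dist x y = eucl_dist y x.
Proof.
rewrite /eucl_dist; congr Num.sqrt.
by apply: eq_bigr => i _; rewrite -sqrrN opprB.
Qed.

Lemma ler_eucl_distD {R : realType} {k : nat} (z x y : 'rV[R]_k) :
  eucl_dist x y <= eucl_dist x z + eucl_dist z y.
Proof.
rewrite !eucl_dist_lp_norm; apply: le_trans (ler_lp_normD _ _ _); last first.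
  by rewrite ler1n.
by apply: le_lp_norm => // i; rewrite addrA subrK.
Qed.

Lemma isometry_dist_lp_norm {R : realType} {k : nat} (p : R)
    (X : {fset 'rV[R]_k}) (f g : 'rV[R]_k -> 'rV[R]_k) :
  isometry_dist p X f g =
  lp_norm p (fun x : X => eucl_dist (f (val x)) (g (val x))).
Proof.
rewrite /isometry_dist /lp_norm; congr (_ `^ _); apply: eq_bigr => x _.
by rewrite ger0_norm// eucl_dist_ge0.
Qed.

Lemma isometry_distC {R : realType} {k : nat} (p : R)
    (X : {fset 'rV[R]_k}) (f g : 'rV[R]_k -> 'rV[R]_k) :
  isometry_dist p X f g = isometry_dist p X g f.
Proof.
by rewrite /isometry_dist; under eq_bigr do rewrite eucl_distC.
Qed.

(** * Bijections onto the image as permutations *)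

Lemma restriction_bij {T : choiceType} (f : T -> T) (X : {fset T}) :
  injective f -> bijective (@restriction T f X).
Proof.
move=> fi; apply: inj_card_bij.
  by move=> x y /(congr1 val)/= /fi /val_inj.
by rewrite -!cardfE card_imfset.
Qed.

Lemma other_bijections_comp {T : choiceType} (f : T -> T) (X : {fset T})
    (t : X -> X) : injective f -> bijective t -> t <> id ->
  other_bijections f X (@restriction T f X \o t).
Proof.
move=> fi tb tid; split; first by apply: bij_comp => //; exact: restriction_bij.
move=> ft; apply: tid; apply/funext => x.
have /bij_inj := restriction_bij f X fi; apply.
exact: (congr1 (fun h => h x) ft).
Qed.

Lemma other_bijectionsP {T : choiceType} (f : T -> T) (X : {fset T})
    (g : X -> (f @` X)%fset) : injective f -> other_bijections f X g ->
  exists t : X -> X, [/\ bijective t, t <> id & g = @restriction T f X \o t].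
Proof.
move=> fi [gb gf]; have [h hK Kh] := restriction_bij f X fi.
have gE : g = @restriction T f X \o (h \o g)
  by apply/funext => x /=; rewrite Kh.
exists (h \o g); split => //.
  by apply: bij_comp => //; exists (@restriction T f X).
by move=> hg; apply: gf; rewrite gE hg.
Qed.

(** * The symmetry defect as a greatest lower bound over permutations *)

(** The p-th root is part of the cost so that the bounds below compare norms and
    Minkowski's inequality applies to them directly. *)
Definition shuffle_cost {R : realType} {k : nat} (p : R) (X : {fset 'rV[R]_k})
    (f : 'rV[R]_k -> 'rV[R]_k) (t : X -> X) : R :=
  lp_norm p (fun x => eucl_dist (val x) (f (val (t x)))).

Lemma shuffle_cost_powR {R : realType} {k : nat} (p : R) (X : {fset 'rV[R]_k})
    (f : 'rV[R]_k -> 'rV[R]_k) (t : X -> X) : p != 0 ->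
  shuffle_cost p X f t `^ p =
  \sum_(x : X) eucl_dist (val x) (val (restriction f (t x))) `^ p.
Proof.
move=> p0; rewrite lp_norm_powR//; apply: eq_bigr => x _.
by rewrite ger0_norm// eucl_dist_ge0.
Qed.

Lemma symmetry_defect_le_cost {R : realType} {k : nat} {p : R}
    {X : {fset 'rV[R]_k}} {f : 'rV[R]_k -> 'rV[R]_k} {t : X -> X} :
  0 < p -> injective f -> bijective t -> t <> id ->
  symmetry_defect p X f <= shuffle_cost p X f t.
Proof.
move=> p0 fi tb tid; rewrite /symmetry_defect; set E := [set _ | _ in _].
have lbE : lbound E 0.
  by move=> _ [g _ <-]; apply: sumr_ge0 => x _; exact: powR_ge0.
have Et : E (shuffle_cost p X f t `^ p).
  exists (@restriction _ f X \o t); first exact: other_bijections_comp.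
  by rewrite shuffle_cost_powR ?gt_eqF.
rewrite -[leRHS](@powRK _ p) ?gt_eqF ?lp_norm_ge0//.
apply: ge0_ler_powR; rewrite ?nnegrE ?powR_ge0 ?invr_ge0 ?(ltW p0)//.
  by apply: lb_le_inf => //; exists (shuffle_cost p X f t `^ p).
by apply: ge_inf => //; exists 0.
Qed.

(** This is why the infimum defining the defect is that of a nonempty set, and
    not the default value of [inf]. *)
Lemma exists_shuffle {T : choiceType} {X : {fset T}} :
  (1 < #|` X|)%N -> exists2 t : X -> X, bijective t & t <> id.
Proof.
rewrite cardfE => /card_gt1P[x [y [_ _ xy]]].
exists (tperm x y); first by exists (tperm x y); exact: tpermK.
move=> /(congr1 (fun h => h x)); rewrite tpermL => yx.
by rewrite yx eqxx in xy.
Qed.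

(** Since p-th powers and p-th roots are increasing on the nonnegative reals,
    they carry lower bounds of the costs to lower bounds of their p-th powers and
    back; a nonpositive [m] is a lower bound of the defect by its sign alone. *)
Lemma le_symmetry_defect {R : realType} {k : nat} {p m : R}
    {X : {fset 'rV[R]_k}} {f : 'rV[R]_k -> 'rV[R]_k} :
  0 < p -> injective f -> (1 < #|` X|)%N ->
  (forall t : X -> X, bijective t -> t <> id -> m <= shuffle_cost p X f t) ->
  m <= symmetry_defect p X f.
Proof.
move=> p0 fi X2 mt; have [m0|m0] := leP m 0.
  by apply: le_trans m0 _; exact: powR_ge0.
rewrite -[leLHS](@powRK _ p) ?gt_eqF ?(ltW m0)//.
have mE : m `^ p <= inf [set \sum_(x : X) eucl_dist (val x) (val (g x)) `^ p
       | g in other_bijections f X].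
  apply: lb_le_inf.
    have [t tb tid] := exists_shuffle X2.
    by eexists; exists (@restriction _ f X \o t);
      first exact: other_bijections_comp.
  move=> _ [g /(other_bijectionsP _ _ _ fi)[t [tb tid ->]] <-].
  rewrite -shuffle_cost_powR ?gt_eqF//.
  by apply: ge0_ler_powR; rewrite ?nnegrE ?lp_norm_ge0 ?(ltW p0) ?(ltW m0) ?mt.
apply: ge0_ler_powR; rewrite ?nnegrE ?invr_ge0 ?(ltW p0) ?powR_ge0//.
by apply: le_trans mE; exact: powR_ge0.
Qed.

(** * Comparison of two defects *)

(** The intermediate point is g(t x). The correction d(g(t x), f(t x)) is the
    term of index [t x] of the distance between [g] and [f], so reindexing by
    [t] removes the dependence on the permutation. *)
Lemma shuffle_cost_le_add {R : realType} {k : nat} {p : R} {X : {fset 'rV[R]_k}}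
    (f g : 'rV[R]_k -> 'rV[R]_k) {t : X -> X} :
  1 <= p -> bijective t ->
  shuffle_cost p X f t <= shuffle_cost p X g t + isometry_dist p X g f.
Proof.
move=> p1 tb; rewrite isometry_dist_lp_norm -(lp_norm_reindex p _ _ tb).
apply: le_trans (ler_lp_normD _ _ p1).
apply: le_lp_norm => [|x]; first exact: le_trans p1.
by rewrite !ger0_norm ?addr_ge0 ?eucl_dist_ge0// ler_eucl_distD.
Qed.

Lemma symmetry_defect_le_add {R : realType} {k : nat} {p : R}
    {X : {fset 'rV[R]_k}} {f g : 'rV[R]_k -> 'rV[R]_k} :
  1 <= p -> (1 < #|` X|)%N -> injective f -> injective g ->
  symmetry_defect p X f <= symmetry_defect p X g + isometry_dist p X g f.
Proof.
move=> p1 X2 fi gi; have p0 : 0 < p by exact: lt_le_trans p1.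
rewrite -lerBlDr; apply: le_symmetry_defect => // t tb tid; rewrite lerBlDr.
apply: le_trans (shuffle_cost_le_add f g p1 tb).
exact: symmetry_defect_le_cost.
Qed.

Theorem theorem2p3p9 (R : realType) (n k : nat) (p : R)
    (hn : (2 <= n)%N) (hp : 1 <= p)
    (X : {fset 'rV[R]_k}) (hX : Conf R n k X)
    (pi sigma : 'rV[R]_k -> 'rV[R]_k)
    (hpi : is_isometry pi) (hsigma : is_isometry sigma) :
  `| symmetry_defect p X pi - symmetry_defect p X sigma |
    <= isometry_dist p X pi sigma.
Proof.
have X2 : (1 < #|` X|)%N by rewrite hX.
have [/bij_inj pi_inj _] := hpi; have [/bij_inj sigma_inj _] := hsigma.
rewrite ler_norml lerNl opprB !lerBlDl symmetry_defect_le_add//=.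
by rewrite isometry_distC symmetry_defect_le_add.
Qed.
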